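(* Let $R$ be a commutative Noetherian ring of prime characteristic $p$ that is $F$-finite, let $I$ be an injective $R$-module, and fix an $(R,R)$-bimodule isomorphism $\Psi : {}_fI \to \operatorname{Hom}_{rR}(R_f, I)$. Then there is a contravariant functor $\mathbf{D}'$ from the category of right $R[x,f]$-modules to the category of left $R[x,f]$-modules which maps a right $R[x,f]$-module $(M,\beta)$ to the left $R[x,f]$-module $(M^\vee, D'(\beta))$, where $D'(\beta) : R_f\otimes_R M^\vee \to M^\vee$ is the left $R$-homomorphism given by $$(D'(\beta)(r\otimes h))(m) = \big(\Psi^{-1}(r'\mapsto h(\beta(m\otimes r')))\big)\,r \quad\text{for all } h\in M^\vee,\ r\in R_f,\ m\in M.$$
   Context: $f : R \to R$, $f(r)=r^p$, is the Frobenius homomorphism; $R$ is $F$-finite if $f$ is a finite ring homomorphism. The Frobenius skew polynomial ring $R[x,f]$ is freely generated as a left $R$-module by $(x^i)_{i\ge 0}$, with multiplication subject to $xr = r^p x$ for $r\in R$. Since $R$ is commutative, $R$-modules are regarded as both left and right $R$-modules. Bimodules: $R_f$ is $R$ as an Abelian group with $r\cdot m\cdot s = r s^p m$; ${}_fI$ is $I$ as an Abelian group with $r\cdot z\cdot s = r^p s z$. $\operatorname{Hom}_{rR}(R_f,I)$ is the group of right $R$-homomorphisms $R_f\to I$ (additive $\psi$ with $\psi(rs^p)=\psi(r)s$), an $(R,R)$-bimodule via $(s\psi s')(r) = s\,\psi(s'r)$. An isomorphism $\Psi$ as in the claim exists when $R$ is $F$-finite and $I$ is injective. Notation $(H,\alpha)$: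 a left $R[x,f]$-module with underlying $R$-module $H$, where $\alpha : R_f\otimes_R H\to H$ is the left $R$-homomorphism with $xh=\alpha(1\otimes h)$; giving a left $R[x,f]$-module structure extending the $R$-module structure of $H$ is equivalent to giving such an $\alpha$. Notation $(M,\beta)$: a right $R[x,f]$-module with underlying $R$-module $M$, where $\beta : M\otimes_R R_f\to M$ is the right $R$-homomorphism with $mx=\beta(m\otimes 1)$; again giving the structure is equivalent to giving $\beta$. $G^\vee := \operatorname{Hom}_R(G,I)$ for an $R$-module $G$. On morphisms, $\mathbf{D}'(\psi)=\psi^\vee$ for a right $R[x,f]$-homomorphism $\psi$. *)

(* Defs.v *)
From HB Require Import structures.
From mathcomp Require Import all_boot all_order all_algebra.
From mathcomp Require Import generic_quotient ring_quotient.
From mathcomp Require Import boolp.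
From mathcomp Require Import freeg.

Set Implicit Arguments.
Unset Strict Implicit.
Unset Printing Implicit Defensive.

Import GRing.Theory.
Local Open Scope ring_scope.

Definition generated_by (R : comNzRingType) (s : seq R) (J : R -> Prop) :=
  forall x, J x <->
    exists c : 'I_(size s) -> R, x = \sum_(i < size s) c i * s`_i.

Definition is_ideal (R : comNzRingType) (J : R -> Prop) :=
  [/\ J 0, forall x y, J x -> J y -> J (x + y) & forall a x, J x -> J (a * x)].

Definition noetherian (R : comNzRingType) :=
  forall J : R -> Prop, is_ideal J -> exists s : seq R, generated_by s J.

Definition finite_rmorphism (A B : comNzRingType) (f : {rmorphism A -> B}) :=
  exists s : seq B, forall b, exists c : 'I_(size s) -> A,
    b = \sum_(i < size s) f (c i) * s`_i.

Definition F_finite (R : comNzRingType) (p : nat) (charRp : p \in [pchar R]) :=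
  finite_rmorphism (pFrobenius_aut charRp : {rmorphism R -> R}).

Definition injective_module (R : comNzRingType) (I : lmodType R) :=
  forall (A B : lmodType R) (i : {linear A -> B}) (g : {linear A -> I}),
    injective i -> exists h : {linear B -> I}, forall a, h (i a) = g a.

(* rscale v a is the right action v . a. *)
HB.mixin Record Lmodule_isBimodule (R : pzRingType) V of GRing.Lmodule R V := {
  rscale : V -> R -> V;
  rscalerA : forall v a b, rscale (rscale v a) b = rscale v (a * b);
  rscaler1 : forall v, rscale v 1 = v;
  rscalerDl : forall a, {morph rscale^~ a : u v / u + v};
  rscalerDr : forall v, {morph rscale v : a b / a + b};
  rscale_scale : forall a v b, rscale (a *: v) b = a *: rscale v b
}.

#[short(type="bimodType")]
HB.structure Definition Bimodule (R : pzRingType) :=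
  {V of GRing.Lmodule R V & Lmodule_isBimodule R V}.

Record bimodIso (R : pzRingType) (U V : bimodType R) := BimodIso {
  biso :> {linear U -> V};
  biso_rscale : forall u a, biso (rscale u a) = rscale (biso u) a;
  biso_inv : V -> U;
  bisoK : cancel biso biso_inv;
  biso_invK : cancel biso_inv biso
}.

(* A module over a commutative ring, with equal left and right actions. *)
Definition central (R : comNzRingType) (M : lmodType R) : Type := M.

Section Central.
Variables (R : comNzRingType) (M : lmodType R).

HB.instance Definition _ := GRing.Lmodule.copy (central M) M.

Let rs (v : central M) (a : R) : central M := a *: v.

Fact central_rsA v a b : rs (rs v a) b = rs v (a * b).
Proof. by rewrite /rs scalerA mulrC. Qed.
Fact central_rs1 v : rs v 1 = v. Proof. exact: scale1r. Qed.
Fact central_rsDl a : {morph rs^~ a : u v / u + v}.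
Proof. by move=> u v; apply: scalerDr. Qed.
Fact central_rsDr v : {morph rs v : a b / a + b}.
Proof. by move=> a b; apply: scalerDl. Qed.
Fact central_rs_scale a v b : rs (a *: v) b = a *: rs v b.
Proof. by rewrite /rs !scalerA mulrC. Qed.

HB.instance Definition _ := Lmodule_isBimodule.Build R (central M)
  central_rsA central_rs1 central_rsDl central_rsDr central_rs_scale.
End Central.

(* R_f : r . m . s = r s^p m. *)
Definition Rf (R : comNzRingType) (p : nat) (charRp : p \in [pchar R]) : Type :=
  R.

(* _f I : r . z . s = r^p s z. *)
Definition fI (R : comNzRingType) (p : nat) (charRp : p \in [pchar R])
  (I : lmodType R) : Type := I.

Section FrobeniusBimodules.
Variables (R : comNzRingType) (p : nat) (charRp : p \in [pchar R]).
Variable I : lmodType R.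

Local Notation "x ^f" := (pFrobenius_aut charRp x).

HB.instance Definition _ := GRing.Lmodule.copy (Rf charRp) R^o.

Let rs (m : Rf charRp) (s : R) : Rf charRp := (s^f * m : R).

Fact Rf_rsA m a b : rs (rs m a) b = rs m (a * b).
Proof. by rewrite /rs rmorphM mulrA [in RHS](mulrC a^f). Qed.
Fact Rf_rs1 m : rs m 1 = m. Proof. by rewrite /rs rmorph1 mul1r. Qed.
Fact Rf_rsDl a : {morph rs^~ a : u v / u + v}.
Proof. by move=> u v; apply: mulrDr. Qed.
Fact Rf_rsDr m : {morph rs m : a b / a + b}.
Proof. by move=> a b; rewrite /rs rmorphD; apply: mulrDl. Qed.
Fact Rf_rs_scale a m b : rs (a *: m) b = a *: rs m b.
Proof. exact: mulrCA. Qed.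

HB.instance Definition _ := Lmodule_isBimodule.Build R (Rf charRp)
  Rf_rsA Rf_rs1 Rf_rsDl Rf_rsDr Rf_rs_scale.

HB.instance Definition _ := GRing.Zmodule.copy (fI charRp I) I.

Let ls (r : R) (z : fI charRp I) : fI charRp I := (r^f *: z : I).

Fact fI_lsA a b v : ls a (ls b v) = ls (a * b) v.
Proof. by rewrite /ls scalerA rmorphM. Qed.
Fact fI_ls1 : left_id 1 ls.
Proof. by move=> v; rewrite /ls rmorph1 scale1r. Qed.
Fact fI_lsDr : right_distributive ls +%R.
Proof. by move=> a u v; apply: scalerDr. Qed.
Fact fI_lsDl v : {morph ls^~ v : a b / a + b}.
Proof. by move=> a b; rewrite /ls rmorphD; apply: scalerDl. Qed.

HB.instance Definition _ := GRing.Zmodule_isLmodule.Build R (fI charRp I)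
  fI_lsA fI_ls1 fI_lsDr fI_lsDl.

Let rsI (z : fI charRp I) (s : R) : fI charRp I := (s *: (z : I) : I).

Fact fI_rsA v a b : rsI (rsI v a) b = rsI v (a * b).
Proof. by rewrite /rsI (@scalerA R I) mulrC. Qed.
Fact fI_rs1 v : rsI v 1 = v. Proof. exact: (@scale1r R I v). Qed.
Fact fI_rsDl a : {morph rsI^~ a : u v / u + v}.
Proof. by move=> u v; apply: (@scalerDr R I). Qed.
Fact fI_rsDr v : {morph rsI v : a b / a + b}.
Proof. by move=> a b; apply: (@scalerDl R I). Qed.
Fact fI_rs_scale a v b : rsI (a *: v) b = a *: rsI v b.
Proof. by rewrite /rsI [LHS](@scalerA R I) [RHS](@scalerA R I) mulrC. Qed.

HB.instance Definition _ := Lmodule_isBimodule.Build R (fI charRp I)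
  fI_rsA fI_rs1 fI_rsDl fI_rsDr fI_rs_scale.

End FrobeniusBimodules.

Record rHom (R : pzRingType) (U V : bimodType R) := RHom {
  rhom_fun :> U -> V;
  rhomD : {morph rhom_fun : x y / x + y};
  rhomZ : forall x a, rhom_fun (rscale x a) = rscale (rhom_fun x) a
}.

Lemma rHom_ext (R : pzRingType) (U V : bimodType R) (f g : rHom U V) :
  f =1 g -> f = g.
Proof.
case: f g => [f fD fZ] [g gD gZ] /= /funext fg; case: _ / fg in gD gZ *.
by congr RHom; apply: Prop_irrelevance.
Qed.

Section RHomBimodule.
Variables (R : pzRingType) (U V : bimodType R).
Implicit Types (f g : rHom U V) (r s : R).

HB.instance Definition _ := gen_eqMixin (rHom U V).
HB.instance Definition _ := gen_choiceMixin (rHom U V).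

Lemma rscale0l (W : bimodType R) a : rscale (0 : W) a = 0.
Proof. by apply: (addIr (rscale 0 a)); rewrite -rscalerDl !add0r. Qed.
Lemma rscaleNl (W : bimodType R) (u : W) a : rscale (- u) a = - rscale u a.
Proof. by apply: (addIr (rscale u a)); rewrite -rscalerDl !addNr rscale0l. Qed.

Fact rhom_zero_D : {morph (fun _ : U => 0 : V) : x y / x + y}.
Proof. by move=> x y; rewrite addr0. Qed.
Fact rhom_zero_Z (x : U) a : 0 = rscale (0 : V) a.
Proof. by rewrite rscale0l. Qed.
Definition rhom_zero : rHom U V := RHom rhom_zero_D rhom_zero_Z.

Fact rhom_opp_D f : {morph (fun x => - f x) : x y / x + y}.
Proof. by move=> x y; rewrite rhomD opprD. Qed.
Fact rhom_opp_Z f x a : - f (rscale x a) = rscale (- f x) a.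
Proof. by rewrite rhomZ rscaleNl. Qed.
Definition rhom_opp f : rHom U V := RHom (rhom_opp_D f) (@rhom_opp_Z f).

Fact rhom_add_D f g : {morph (fun x => f x + g x) : x y / x + y}.
Proof. by move=> x y; rewrite !rhomD addrACA. Qed.
Fact rhom_add_Z f g x a :
  f (rscale x a) + g (rscale x a) = rscale (f x + g x) a.
Proof. by rewrite !rhomZ rscalerDl. Qed.
Definition rhom_add f g : rHom U V := RHom (rhom_add_D f g) (@rhom_add_Z f g).

Fact rhom_addA : associative rhom_add.
Proof. by move=> f g h; apply: rHom_ext => x; apply: addrA. Qed.
Fact rhom_addC : commutative rhom_add.
Proof. by move=> f g; apply: rHom_ext => x; apply: addrC. Qed.
Fact rhom_add0 : left_id rhom_zero rhom_add.
Proof. by move=> f; apply: rHom_ext => x; apply: add0r. Qed.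
Fact rhom_addN : left_inverse rhom_zero rhom_opp rhom_add.
Proof. by move=> f; apply: rHom_ext => x; apply: addNr. Qed.
HB.instance Definition _ := GRing.isZmodule.Build (rHom U V)
  rhom_addA rhom_addC rhom_add0 rhom_addN.

(* (s f s')(x) = s f(s' x) *)
Fact rhom_scale_D s f : {morph (fun x => s *: f x) : x y / x + y}.
Proof. by move=> x y; rewrite rhomD scalerDr. Qed.
Fact rhom_scale_Z s f x a : s *: f (rscale x a) = rscale (s *: f x) a.
Proof. by rewrite rhomZ rscale_scale. Qed.
Definition rhom_scale s f : rHom U V :=
  RHom (rhom_scale_D s f) (@rhom_scale_Z s f).

Fact rhom_scaleA r s f : rhom_scale r (rhom_scale s f) = rhom_scale (r * s) f.
Proof. by apply: rHom_ext => x; apply: scalerA. Qed.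
Fact rhom_scale1 : left_id 1 rhom_scale.
Proof. by move=> f; apply: rHom_ext => x; apply: scale1r. Qed.
Fact rhom_scaleDr : right_distributive rhom_scale +%R.
Proof. by move=> s f g; apply: rHom_ext => x; apply: scalerDr. Qed.
Fact rhom_scaleDl f : {morph rhom_scale^~ f : r s / r + s}.
Proof. by move=> r s; apply: rHom_ext => x; apply: scalerDl. Qed.
HB.instance Definition _ := GRing.Zmodule_isLmodule.Build R (rHom U V)
  rhom_scaleA rhom_scale1 rhom_scaleDr rhom_scaleDl.

Fact rhom_rscale_D f s : {morph (fun x => f (s *: x)) : x y / x + y}.
Proof. by move=> x y; rewrite scalerDr rhomD. Qed.
Fact rhom_rscale_Z f s x a : f (s *: rscale x a) = rscale (f (s *: x)) a.
Proof. by rewrite -rscale_scale rhomZ. Qed.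
Definition rhom_rscale f s : rHom U V :=
  RHom (rhom_rscale_D f s) (@rhom_rscale_Z f s).

Fact rhom_rscaleA f r s : rhom_rscale (rhom_rscale f r) s = rhom_rscale f (r * s).
Proof. by apply: rHom_ext => x /=; rewrite scalerA. Qed.
Fact rhom_rscale1 f : rhom_rscale f 1 = f.
Proof. by apply: rHom_ext => x /=; rewrite scale1r. Qed.
Fact rhom_rscaleDl s : {morph rhom_rscale^~ s : f g / f + g}.
Proof. by move=> f g; apply: rHom_ext. Qed.
Fact rhom_rscaleDr f : {morph rhom_rscale f : r s / r + s}.
Proof. by move=> r s; apply: rHom_ext => x /=; rewrite scalerDl rhomD. Qed.
Fact rhom_rscale_scale r f s :
  rhom_rscale (r *: f) s = r *: rhom_rscale f s.
Proof. by apply: rHom_ext. Qed.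
HB.instance Definition _ := Lmodule_isBimodule.Build R (rHom U V)
  rhom_rscaleA rhom_rscale1 rhom_rscaleDl rhom_rscaleDr rhom_rscale_scale.

End RHomBimodule.

Lemma linear_ext (R : pzRingType) (U V : lmodType R) (f g : {linear U -> V}) :
  f =1 g -> f = g.
Proof.
case: f g => [f [[f1] [f2]]] [g [[g1] [g2]]] /= /funext fg.
case: _ / fg in g1 g2 *.
by rewrite (Prop_irrelevance f1 g1) (Prop_irrelevance f2 g2).
Qed.

Definition dual (R : comNzRingType) (I G : lmodType R) : Type := {linear G -> I}.

Section DualModule.
Variables (R : comNzRingType) (I G : lmodType R).
Implicit Types (f g h : dual I G) (r s : R).

HB.instance Definition _ := gen_eqMixin (dual I G).
HB.instance Definition _ := gen_choiceMixin (dual I G).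

Let zero : dual I G := (\0 : {linear G -> I}).
Let opp f : dual I G := (\- f : {linear G -> I}).
Let add f g : dual I G := (f \+ g : {linear G -> I}).

Fact dual_addA : associative add.
Proof. by move=> f g h; apply: linear_ext => x; apply: addrA. Qed.
Fact dual_addC : commutative add.
Proof. by move=> f g; apply: linear_ext => x; apply: addrC. Qed.
Fact dual_add0 : left_id zero add.
Proof. by move=> f; apply: linear_ext => x; apply: add0r. Qed.
Fact dual_addN : left_inverse zero opp add.
Proof. by move=> f; apply: linear_ext => x; apply: addNr. Qed.
HB.instance Definition _ := GRing.isZmodule.Build (dual I G)
  dual_addA dual_addC dual_add0 dual_addN.

Let scale r f : dual I G := (r \*: f : {linear G -> I}).

Fact dual_scaleA r s f : scale r (scale s f) = scale (r * s) f.
Proof. by apply: linear_ext => x; apply: scalerA. Qed.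
Fact dual_scale1 : left_id 1 scale.
Proof. by move=> f; apply: linear_ext => x; apply: scale1r. Qed.
Fact dual_scaleDr : right_distributive scale +%R.
Proof. by move=> s f g; apply: linear_ext => x; apply: scalerDr. Qed.
Fact dual_scaleDl f : {morph scale^~ f : r s / r + s}.
Proof. by move=> r s; apply: linear_ext => x; apply: scalerDl. Qed.
HB.instance Definition _ := GRing.Zmodule_isLmodule.Build R (dual I G)
  dual_scaleA dual_scale1 dual_scaleDr dual_scaleDl.

End DualModule.

Section Tensor.
Variables (R : pzRingType) (U V : bimodType R).

Local Notation F := {freeg (U * V)%type}.

(* U (x)_R V is the quotient of the free abelian group on U x V by tens_rel. *)
Inductive tens_rel : F -> Prop :=
| tens_rel0 : tens_rel 0
| tens_relB x y : tens_rel x -> tens_rel y -> tens_rel (x - y)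
| tens_relDl u u' v :
    tens_rel (<< (u + u', v) >> - << (u, v) >> - << (u', v) >>)
| tens_relDr u v v' :
    tens_rel (<< (u, v + v') >> - << (u, v) >> - << (u, v') >>)
| tens_relA u a v :
    tens_rel (<< (rscale u a, v) >> - << (u, a *: v) >>).

Definition tens_relb : F -> bool := fun x => `[< tens_rel x >].

Fact tens_relb_zmod_closed : zmod_closed tens_relb.
Proof.
split=> [|x y /asboolP xP /asboolP yP]; apply/asboolP.
  exact: tens_rel0.
exact: tens_relB.
Qed.
HB.instance Definition _ := GRing.isZmodClosed.Build F tens_relb
  tens_relb_zmod_closed.

Definition tens_subgroup : zmodClosed F := GRing.ZmodClosed.clone F tens_relb _.

Definition tensor : Type := Quotient.quot tens_subgroup.
HB.instance Definition _ :=
  GRing.Zmodule.copy tensor (Quotient.quot tens_subgroup).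

Definition tens_pi (x : F) : tensor := (\pi_(Quotient.quot tens_subgroup) x)%qT.

Definition tens (u : U) (v : V) : tensor := tens_pi << (u, v) >>.

Lemma tens_piB : {morph tens_pi : x y / x - y}.
Proof. exact: (raddfB (\pi_(Quotient.quot tens_subgroup))%qT). Qed.

Lemma tens_piD : {morph tens_pi : x y / x + y}.
Proof. exact: (raddfD (\pi_(Quotient.quot tens_subgroup))%qT). Qed.

Lemma tens_piP x y : tens_rel (x - y) <-> tens_pi x = tens_pi y.
Proof.
by split=> [/asboolP xyP|/eqP]; [apply/eqP|move=> xyP; apply/asboolP];
   move: xyP; rewrite -Quotient.idealrBE.
Qed.

Lemma tensDl u u' v : tens (u + u') v = tens u v + tens u' v.
Proof.
by rewrite -tens_piD; apply/tens_piP; rewrite opprD addrA; apply: tens_relDl.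
Qed.

Lemma tensDr u v v' : tens u (v + v') = tens u v + tens u v'.
Proof.
by rewrite -tens_piD; apply/tens_piP; rewrite opprD addrA; apply: tens_relDr.
Qed.

Lemma tensA u a v : tens (rscale u a) v = tens u (a *: v).
Proof. exact/tens_piP/tens_relA. Qed.

Lemma tens_ext (W : zmodType) (f g : tensor -> W) :
    {morph f : x y / x + y} -> {morph g : x y / x + y} ->
  (forall u v, f (tens u v) = g (tens u v)) -> f =1 g.
Proof.
move=> fD gD fg; have eq0 h : {morph h : x y / x + y} -> h (0 : tensor) = 0 :> W.
  by move=> hD; apply: (addIr (h 0)); rewrite -hD !add0r.
have eqN h : {morph h : x y / x + y} -> forall x : tensor, h (- x) = - h x :> W.
  move=> hD x; apply: (addIr (h x)).
  by rewrite -hD !addNr; apply: eq0.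
have tens0 : tens_pi 0 = 0 by rewrite -(subrr 0) tens_piB subrr.
have fgZ (k : int) uv : f (tens_pi << k *g uv >>) = g (tens_pi << k *g uv >>).
  have -> : << k *g uv >> = << uv >> *~ k :> F by rewrite freegU_mulz intz.
  have pos n : f (tens_pi (<< uv >> *+ n)) = g (tens_pi (<< uv >> *+ n)).
    elim: n => [|n IHn]; first by rewrite mulr0n tens0 !eq0.
    rewrite mulrS tens_piD fD gD IHn; congr (_ + _).
    by case: uv {IHn} => u v; apply: fg.
  case: k => n; first by rewrite -pmulrn.
  by rewrite NegzE mulrNz -sub0r tens_piB tens0 sub0r !eqN // -pmulrn pos.
move=> t; rewrite -[t](@reprK _ (Quotient.quot tens_subgroup)).
rewrite -/(tens_pi _); move: (repr _) => x; rewrite -(freeg_sumE x).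
elim/big_rec: _ => [|uv y _ IHy]; first by rewrite tens0 !eq0.
by rewrite tens_piD fD gD IHy fgZ.
Qed.

(* The additive map induced by a biadditive balanced map phi. *)
Definition tlift (W : zmodType) (phi : U -> V -> W) (t : tensor) : W :=
  fglift (fun uv => phi uv.1 uv.2 : zmodule W)
    (repr (t : Quotient.quot tens_subgroup))%qT.

Definition balanced (W : zmodType) (phi : U -> V -> W) :=
  [/\ forall v, {morph phi^~ v : u u' / u + u'},
      forall u, {morph phi u : v v' / v + v'}
    & forall u a v, phi (rscale u a) v = phi u (a *: v)].

Lemma tlift_pi (W : zmodType) (phi : U -> V -> W) : balanced phi ->
  forall x, tlift phi (tens_pi x)
            = fglift (fun uv => phi uv.1 uv.2 : zmodule W) x.
Proof.
case=> phiDl phiDr phiA x; set L := fglift _.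
have LB : {morph L : x y / x - y} := @lift_is_additive _ _ _ _.
have L0 : L 0 = 0 by rewrite -(subrr 0) LB subrr.
have L1 u v : L << (u, v) >> = phi u v by rewrite /L liftU scale1r.
have Lrel y : tens_rel y -> L y = 0.
  elim=> {y} // [y z _ Ly _ Lz|u u' v|u v v'|u a v]; rewrite !LB ?L1 //=.
  - by rewrite Ly Lz subrr.
  - by rewrite phiDl addrAC addrK subrr.
  - by rewrite phiDr addrAC addrK subrr.
  - by rewrite phiA subrr.
rewrite /tlift -/L; apply: subr0_eq; rewrite -LB; apply: Lrel.
by apply/tens_piP; rewrite /tens_pi reprK.
Qed.

Lemma tlift_tens (W : zmodType) (phi : U -> V -> W) : balanced phi ->
  forall u v, tlift phi (tens u v) = phi u v.
Proof. by move=> phiP u v; rewrite tlift_pi // liftU scale1r. Qed.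

Lemma tliftD (W : zmodType) (phi : U -> V -> W) : balanced phi ->
  {morph tlift phi : x y / x + y}.
Proof.
move=> phiP x y; rewrite -[x](@reprK _ (Quotient.quot tens_subgroup)).
rewrite -[y](@reprK _ (Quotient.quot tens_subgroup)) -!/(tens_pi _).
rewrite -tens_piD !tlift_pi //; set L := fglift _.
have LB : {morph L : x y / x - y} := @lift_is_additive _ _ _ _.
have L0 : L 0 = 0 by rewrite -(subrr 0) LB subrr.
move: (repr _) (repr _) => a b.
by rewrite -[a in LHS]opprK -[- a]sub0r -[b + _]/(b - _) !LB L0 sub0r opprK.
Qed.

(* r . (u (x) v) . s = (r . u) (x) (v . s) *)
Let ls (r : R) : tensor -> tensor := tlift (fun u v => tens (r *: u) v).
Let rs (t : tensor) (s : R) : tensor := tlift (fun u v => tens u (rscale v s)) t.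

Fact ls_balanced r : balanced (fun u v => tens (r *: u) v).
Proof.
split=> [v u u'|u v v'|u a v]; first by rewrite scalerDr tensDl.
  exact: tensDr.
by rewrite -rscale_scale tensA.
Qed.

Fact rs_balanced s : balanced (fun u v => tens u (rscale v s)).
Proof.
split=> [v u u'|u v v'|u a v]; first exact: tensDl.
  by rewrite rscalerDl tensDr.
by rewrite tensA rscale_scale.
Qed.

Let lsD r : {morph ls r : x y / x + y}. Proof. exact/tliftD/ls_balanced. Qed.
Let rsD s : {morph rs^~ s : x y / x + y}. Proof. exact/tliftD/rs_balanced. Qed.
Let lsE r u v : ls r (tens u v) = tens (r *: u) v.
Proof. exact/tlift_tens/ls_balanced. Qed.
Let rsE s u v : rs (tens u v) s = tens u (rscale v s).
Proof. exact/tlift_tens/rs_balanced. Qed.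

Fact tensor_lsA a b t : ls a (ls b t) = ls (a * b) t.
Proof.
move: t; apply: tens_ext => [x y|x y|u v]; rewrite ?lsD //.
by rewrite !lsE scalerA.
Qed.
Fact tensor_ls1 : left_id 1 ls.
Proof.
apply: tens_ext => [x y|x y|u v]; rewrite ?lsD //.
by rewrite !lsE scale1r.
Qed.
Fact tensor_lsDl t : {morph ls^~ t : a b / a + b}.
Proof.
move=> a b; move: t; apply: tens_ext => [x y|x y|u v]; rewrite ?lsD //.
  by rewrite addrACA.
by rewrite !lsE scalerDl tensDl.
Qed.
HB.instance Definition _ := GRing.Zmodule_isLmodule.Build R tensor
  tensor_lsA tensor_ls1 lsD tensor_lsDl.

Fact tensor_rsA t a b : rs (rs t a) b = rs t (a * b).
Proof.
move: t; apply: tens_ext => [x y|x y|u v]; rewrite ?rsD //.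
by rewrite !rsE rscalerA.
Qed.
Fact tensor_rs1 t : rs t 1 = t.
Proof.
move: t; apply: tens_ext => [x y|x y|u v]; rewrite ?rsD //.
by rewrite !rsE rscaler1.
Qed.
Fact tensor_rsDr t : {morph rs t : a b / a + b}.
Proof.
move=> a b; move: t; apply: tens_ext => [x y|x y|u v]; rewrite ?rsD //.
  by rewrite addrACA.
by rewrite !rsE rscalerDr tensDr.
Qed.
Fact tensor_rs_ls a t b : rs (ls a t) b = ls a (rs t b).
Proof.
move: t; apply: tens_ext => [x y|x y|u v]; rewrite ?(rsD, lsD) //.
by rewrite lsE rsE rsE lsE.
Qed.
HB.instance Definition _ := Lmodule_isBimodule.Build R tensor
  tensor_rsA tensor_rs1 rsD tensor_rsDr tensor_rs_ls.

Lemma scale_tens r u v : r *: tens u v = tens (r *: u) v.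
Proof. exact: lsE. Qed.

Lemma rscale_tens u v s : rscale (tens u v) s = tens u (rscale v s).
Proof. exact: rsE. Qed.

End Tensor.

(* The left R-module {poly R} with the product determined by x r = r^p x. *)
Definition skewPoly (R : comNzRingType) (p : nat) (charRp : p \in [pchar R]) :
  Type := {poly R}.

Section SkewPoly.
Variables (R : comNzRingType) (p : nat) (charRp : p \in [pchar R]).

HB.instance Definition _ := GRing.Lmodule.copy (skewPoly charRp) {poly R}.

Lemma frobD (j : nat) (a b : R) : (a + b) ^+ (p ^ j) = a ^+ (p ^ j) + b ^+ (p ^ j).
Proof.
apply: exprDn_pchar; rewrite (eq_pnat _ (pcharf_eq charRp)).
by rewrite pnatX pnat_id ?(pcharf_prime charRp).
Qed.

Lemma frob0 (j : nat) : (0 : R) ^+ (p ^ j) = 0.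
Proof. by rewrite expr0n expn_eq0 -leqn0 leqNgt (prime_gt0 (pcharf_prime charRp)). Qed.

Definition skewC (c : R) : skewPoly charRp := c%:P.
Definition skewX : skewPoly charRp := 'X.

(* (a x^i) (b x^j) = a b^(p^i) x^(i+j) *)
Definition skew_mul (P Q : skewPoly charRp) : skewPoly charRp :=
  \poly_(n < size (P : {poly R}) + size (Q : {poly R}))
     \sum_(i < n.+1) (P : {poly R})`_i * (Q : {poly R})`_(n - i) ^+ (p ^ i).

Local Notation cf P n := ((P : {poly R})`_n).

Fact coef_skew_mul P Q n :
  cf (skew_mul P Q) n = \sum_(i < n.+1) cf P i * cf Q (n - i) ^+ (p ^ i).
Proof.
rewrite /skew_mul coef_poly; case: ltnP => // le_n.
rewrite big1 // => i _; have [lePi|ltiP] := leqP (size (P : {poly R})) i.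
  by rewrite nth_default ?mul0r.
rewrite [(Q : {poly R})`__]nth_default ?frob0 ?mulr0 //.
rewrite -(leq_add2l i) subnKC ?leq_ord //.
by apply: leq_trans le_n; rewrite leq_add2r ltnW.
Qed.

Fact coef_skew_mul_rev P Q n :
  cf (skew_mul P Q) n = \sum_(i < n.+1) cf P (n - i) * cf Q i ^+ (p ^ (n - i)).
Proof.
rewrite coef_skew_mul (reindex_inj rev_ord_inj) /=.
by apply: eq_bigr => j _; rewrite (sub_ordK j).
Qed.

Fact frob_sum (j : nat) (J : finType) (F : J -> R) :
  (\sum_i F i) ^+ (p ^ j) = \sum_i F i ^+ (p ^ j).
Proof.
by apply: (big_morph (fun a => a ^+ (p ^ j)) (frobD j) (frob0 j)).
Qed.

Fact skew_mulA : associative skew_mul.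
Proof.
move=> P Q S; apply/polyP=> i.
rewrite [LHS]coef_skew_mul [RHS]coef_skew_mul_rev.
pose coef3 j k := cf P j * (cf Q (i - j - k) ^+ (p ^ j) * cf S k ^+ (p ^ (i - k))).
transitivity (\sum_(j < i.+1) \sum_(k < i.+1 | (k <= i - j)%N) coef3 j k).
  apply: eq_bigr => /= j _; rewrite coef_skew_mul_rev frob_sum big_distrr /=.
  rewrite (big_ord_narrow_leq (leq_subr _ _)); apply: eq_bigr => k _ /=.
  rewrite /coef3 exprMn -exprM -expnD; congr (_ * (_ * _ ^+ (p ^ _))).
  by rewrite addnBAC ?subnK ?leq_ord.
rewrite (exchange_big_dep predT) //=; apply: eq_bigr => k _.
transitivity (\sum_(j < i.+1 | (j <= i - k)%N) coef3 j k).
  apply: eq_bigl => j; rewrite -ltnS -(ltnS j) -!subSn ?leq_ord //.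
  by rewrite -subn_gt0 -(subn_gt0 j) -!subnDA addnC.
rewrite (big_ord_narrow_leq (leq_subr _ _)) coef_skew_mul big_distrl /=.
by apply: eq_bigr => j _; rewrite /coef3 -!subnDA addnC mulrA.
Qed.

Fact skew_mul1l : left_id (skewC 1) skew_mul.
Proof.
move=> P; apply/polyP => i; rewrite coef_skew_mul big_ord_recl subn0 expn0 expr1.
rewrite big1 => [|j _]; rewrite coefC ?mul0r //.
by rewrite eqxx mul1r addr0.
Qed.

Fact skew_mul1r : right_id (skewC 1) skew_mul.
Proof.
move=> P; apply/polyP => i; rewrite coef_skew_mul_rev big_ord_recl subn0.
rewrite big1 => [|j _]; rewrite coefC ?frob0 ?mulr0 //.
by rewrite eqxx expr1n mulr1 addr0.
Qed.

Fact skew_mulDl : left_distributive skew_mul +%R.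
Proof.
move=> P Q S; apply/polyP=> i; rewrite coefD !coef_skew_mul -big_split.
by apply: eq_bigr => j _; rewrite coefD mulrDl.
Qed.

Fact skew_mulDr : right_distributive skew_mul +%R.
Proof.
move=> P Q S; apply/polyP=> i; rewrite coefD !coef_skew_mul -big_split.
by apply: eq_bigr => j _; rewrite coefD frobD mulrDr.
Qed.

Fact skew1_neq0 : skewC 1 != 0.
Proof. by rewrite polyC_eq0 oner_neq0. Qed.

HB.instance Definition _ := GRing.Zmodule_isNzRing.Build (skewPoly charRp)
  skew_mulA skew_mul1l skew_mul1r skew_mulDl skew_mulDr skew1_neq0.

Lemma skew_mono (a b : R) i j :
  (a *: 'X^i : skewPoly charRp) * (b *: 'X^j : skewPoly charRp) =
  (a * b ^+ (p ^ i)) *: 'X^(i + j).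
Proof.
apply/polyP => n; rewrite [LHS]coef_skew_mul coefZ coefXn.
have F0 k : k != i ->
    cf (a *: 'X^i) k * cf (b *: 'X^j) (n - k) ^+ (p ^ k) = 0 :> R.
  by move=> /negPf neq_ki; rewrite coefZ coefXn neq_ki mulr0 mul0r.
have [le_in|lt_ni] := leqP i n; last first.
  rewrite big1 => [|k _]; last first.
    by apply: F0; rewrite neq_ltn (leq_ltn_trans (leq_ord k)).
  by rewrite ltn_eqF ?mulr0 // (leq_trans lt_ni) ?leq_addr.
rewrite (bigD1 (Ordinal (le_in : (i < n.+1)%N))) //= big1 ?addr0 => [|k kP].
  rewrite !coefZ !coefXn eqxx mulr1 -[in RHS](subnKC le_in) eqn_add2l.
  by case: eqP => _; rewrite ?mulr1 // !mulr0 frob0 mulr0.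
by apply: F0; apply: contraNneq kP => ki; apply/eqP/val_inj.
Qed.

Lemma skewCE c : skewC c = c *: 'X^0.
Proof. by rewrite expr0 alg_polyC. Qed.

Lemma skewXE : skewX = 1 *: 'X^1.
Proof. by rewrite scale1r expr1. Qed.

Lemma skewCD a b : skewC (a + b) = skewC a + skewC b.
Proof. exact: polyCD. Qed.

Lemma skewCM a b : skewC (a * b) = skewC a * skewC b.
Proof. by rewrite !skewCE skew_mono expn0 expr1. Qed.

Lemma skewX_mulC r : skewX * skewC r = skewC (r ^+ p) * skewX.
Proof. by rewrite !skewCE !skewXE !skew_mono mul1r expr1n mulr1. Qed.

Lemma skewPoly_sum (P : skewPoly charRp) :
  P = \sum_(i < size (P : {poly R})) skewC (cf P i) * skewX ^+ i.
Proof.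
have Xn n : skewX ^+ n = 1 *: 'X^n.
  elim: n => [|n IHn]; first by rewrite scale1r expr0.
  by rewrite exprS IHn skewXE skew_mono expr1n mulr1.
rewrite -[LHS](coefK (P : {poly R})) poly_def.
apply: eq_bigr => i _.
by rewrite Xn skewCE skew_mono expr1n mulr1.
Qed.

End SkewPoly.

(* (H, alpha): the left R[x, f]-module structure on H extending its R-module  *)
(* structure for which x h = alpha (1 (x) h).                                 *)
Definition leftMod (R : comNzRingType) (p : nat) (charRp : p \in [pchar R])
  (H : lmodType R)
  (alpha : {linear tensor (Rf charRp) (central H) -> H}) : Type := H.

Section LeftModule.
Variables (R : comNzRingType) (p : nat) (charRp : p \in [pchar R]).
Variables (H : lmodType R).
Variable alpha : {linear tensor (Rf charRp) (central H) -> H}.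
Implicit Types (P Q : skewPoly charRp) (h : leftMod alpha).

HB.instance Definition _ := GRing.Zmodule.copy (leftMod alpha) H.

Let phi (h : H) : H := alpha (tens (1 : Rf charRp) (h : central H)).

Definition left_act P h : leftMod alpha :=
  \sum_(i < size (P : {poly R})) (P : {poly R})`_i *: iter i phi h.

Let phiD : {morph phi : g h / g + h}.
Proof. by move=> g h; rewrite /phi tensDr raddfD. Qed.

Let phiZ r (h : H) : phi (r *: h) = r ^+ p *: phi h.
Proof.
rewrite /phi -[X in tens _ X]/(r *: (h : central H)) -tensA.
rewrite -linearZ_LR scale_tens; congr (alpha (tens _ _)).
Qed.

Let iterD i : {morph iter i phi : g h / g + h}.
Proof. by move=> g h; elim: i => //= i ->; rewrite phiD. Qed.

Let iter0 i : iter i phi 0 = 0.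
Proof. by apply: (addIr (iter i phi 0)); rewrite -iterD !add0r. Qed.

Let iterZ i r (h : H) : iter i phi (r *: h) = r ^+ (p ^ i) *: iter i phi h.
Proof. by elim: i => //= i ->; rewrite phiZ -exprM -expnSr. Qed.

Let actE n P h : (size (P : {poly R}) <= n)%N ->
  left_act P h = \sum_(i < n) (P : {poly R})`_i *: iter i phi h.
Proof.
move=> le_Pn; rewrite /left_act.
rewrite (big_ord_widen n (fun i => (P : {poly R})`_i *: iter i phi h)) //.
rewrite big_mkcond; apply: eq_bigr => i _; case: ltnP => // lePi.
by rewrite nth_default // scale0r.
Qed.

Fact left_actDl h : {morph left_act^~ h : P Q / P + Q}.
Proof.
move=> P Q; pose n := maxn (size (P : {poly R})) (size (Q : {poly R})).
rewrite (@actE n) ?size_polyD // (@actE n P) ?leq_maxl // (@actE n Q) ?leq_maxr //.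
by rewrite -big_split; apply: eq_bigr => i _; rewrite /= coefD scalerDl.
Qed.

Fact left_actDr : right_distributive left_act +%R.
Proof.
move=> P g h; rewrite /left_act -big_split; apply: eq_bigr => i _.
by rewrite /= iterD scalerDr.
Qed.

Let act_mono a i h : left_act (a *: 'X^i : {poly R}) h = a *: iter i phi h.
Proof.
rewrite (@actE i.+1) ?(leq_trans (size_scale_leq _ _)) ?size_polyXn //.
rewrite big_ord_recr /= big1 ?add0r => [|j _].
  by rewrite coefZ coefXn eqxx mulr1.
by rewrite coefZ coefXn ltn_eqF // mulr0 scale0r.
Qed.

Fact left_act1 : left_id 1 left_act.
Proof. by move=> h; rewrite -[1]/(skewC charRp 1) skewCE act_mono scale1r. Qed.

Let act_sum (J : finType) (F : J -> skewPoly charRp) h :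
  left_act (\sum_i F i) h = \sum_i left_act (F i) h.
Proof.
apply: (big_morph (left_act^~ h) (left_actDl h)).
by rewrite /left_act size_poly0 big_ord0.
Qed.

Let act_sumr (J : finType) P (F : J -> leftMod alpha) :
  left_act P (\sum_i F i) = \sum_i left_act P (F i).
Proof.
apply: (big_morph (left_act P) (left_actDr P)).
by rewrite /left_act big1 // => i _; rewrite iter0 scaler0.
Qed.

Fact left_actA P Q h : left_act P (left_act Q h) = left_act (P * Q) h.
Proof.
have sumE (S : skewPoly charRp) :
    S = \sum_(i < size (S : {poly R})) ((S : {poly R})`_i *: 'X^i : {poly R}).
  by rewrite -poly_def coefK.
rewrite (sumE P) (sumE Q) mulr_suml !act_sum; apply: eq_bigr => i _.
rewrite mulr_sumr !act_sum act_sumr; apply: eq_bigr => j _.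
rewrite skew_mono !act_mono; move: (P : {poly R})`_i (Q : {poly R})`_j => a b.
by rewrite iterZ scalerA ssrnat.iterD.
Qed.

HB.instance Definition _ := GRing.Zmodule_isLmodule.Build (skewPoly charRp)
  (leftMod alpha) left_actA left_act1 left_actDr left_actDl.

Lemma leftMod_C r h : skewC charRp r *: h = (r *: (h : H) : H).
Proof. by rewrite skewCE; apply: (act_mono r 0 h). Qed.

Lemma leftMod_X h :
  skewX charRp *: h = alpha (tens (1 : Rf charRp) (h : central H)).
Proof.
by rewrite skewXE; apply: etrans (act_mono 1 1 h) _; rewrite scale1r.
Qed.

End LeftModule.

(* Right R[x, f]-modules are the left modules over the converse ring          *)
(* R[x, f]^c; rightRes M is the underlying R-module of M.                     *)
Definition rightRes (R : comNzRingType) (p : nat) (charRp : p \in [pchar R])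
  (M : lmodType (skewPoly charRp)^c) : Type := M.

Section RightModule.
Variables (R : comNzRingType) (p : nat) (charRp : p \in [pchar R]).
Variable M : lmodType (skewPoly charRp)^c.
Implicit Types (r s : R) (m : M).

HB.instance Definition _ := GRing.Zmodule.copy (rightRes M) M.

(* m . P *)
Definition ract m (P : skewPoly charRp) : M := (P : (skewPoly charRp)^c) *: m.

Lemma ractA m P Q : ract (ract m P) Q = ract m (P * Q).
Proof. by rewrite /ract scalerA. Qed.

Let sc r (m : rightRes M) : rightRes M := ract m (skewC charRp r).

Fact rightRes_scaleA r s (m : rightRes M) : sc r (sc s m) = sc (r * s) m.
Proof. by rewrite /sc ractA -skewCM mulrC. Qed.
Fact rightRes_scale1 : left_id 1 sc.
Proof. by move=> m; apply: (@scale1r _ M). Qed.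
Fact rightRes_scaleDr : right_distributive sc +%R.
Proof. by move=> r m n; apply: (@scalerDr _ M). Qed.
Fact rightRes_scaleDl (m : rightRes M) : {morph sc^~ m : r s / r + s}.
Proof. by move=> r s; rewrite /sc skewCD; apply: (@scalerDl _ M). Qed.
HB.instance Definition _ := GRing.Zmodule_isLmodule.Build R (rightRes M)
  rightRes_scaleA rightRes_scale1 rightRes_scaleDr rightRes_scaleDl.

Let b (m : central (rightRes M)) (r : Rf charRp) : central (rightRes M) :=
  ract m (skewC charRp r * skewX charRp).

Fact beta_balanced : balanced b.
Proof.
split=> [r m n|m r s|m a r]; first exact: (@scalerDr _ M).
  rewrite /b skewCD mulrDl; exact: (@scalerDl _ M).
by rewrite /b [LHS]ractA mulrA -skewCM.
Qed.

Fact beta_rscale t a :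
  tlift b (rscale t a) = rscale (tlift b t) a.
Proof.
have bD := tliftD beta_balanced; move: t; apply: tens_ext => [x y|x y|m r].
- by rewrite rscalerDl bD.
- by rewrite bD rscalerDl.
rewrite rscale_tens !tlift_tens; try exact: beta_balanced.
rewrite /b [RHS]ractA -mulrA skewX_mulC mulrA -skewCM.
by rewrite [in RHS]mulrC.
Qed.

(* The map beta of the notation (M, beta): m r x = beta (m (x) r). *)
Definition rightBeta :
  rHom (tensor (central (rightRes M)) (Rf charRp)) (central (rightRes M)) :=
  RHom (tliftD beta_balanced) beta_rscale.

Lemma rightBetaE (m : rightRes M) (r : Rf charRp) :
  rightBeta (tens (m : central (rightRes M)) r)
  = ract m (skewC charRp r * skewX charRp).
Proof. exact: tlift_tens beta_balanced _ _. Qed.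

Lemma rightBeta1 (m : rightRes M) :
  rightBeta (tens (m : central (rightRes M)) (1 : Rf charRp))
  = ract m (skewX charRp).
Proof. by rewrite rightBetaE mul1r. Qed.

End RightModule.

Section EvalHom.
Variables (R : comNzRingType) (p : nat) (charRp : p \in [pchar R]).
Variables (I M : lmodType R).
Variable beta : rHom (tensor (central M) (Rf charRp)) (central M).
Variables (h : dual I M) (m : M).

Let ev (r : Rf charRp) : central I := h (beta (tens (m : central M) r)).

Fact evalHomD : {morph ev : r s / r + s}.
Proof. by move=> r s; rewrite /ev tensDr rhomD; apply: raddfD. Qed.

Fact evalHomZ r a : ev (rscale r a) = rscale (ev r) a.
Proof. by rewrite /ev -rscale_tens rhomZ; apply: linearZ_LR. Qed.

Definition evalHom : rHom (Rf charRp) (central I) := RHom evalHomD evalHomZ.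

End EvalHom.

Record category := Category {
  objc :> Type;
  homc : objc -> objc -> Type;
  idc : forall A, homc A A;
  compc : forall A B C, homc B C -> homc A B -> homc A C;
  comp1c : forall A B (f : homc A B), compc (idc B) f = f;
  compc1 : forall A B (f : homc A B), compc f (idc A) = f;
  compcA : forall A B C D (f : homc C D) (g : homc B C) (h : homc A B),
    compc f (compc g h) = compc (compc f g) h
}.

Record contrafunctor (C D : category) (F0 : C -> D) := Contrafunctor {
  fmap :> forall A B : C, homc A B -> homc (F0 B) (F0 A);
  fmap1 : forall A, fmap (idc A) = idc (F0 A);
  fmapM : forall (A B E : C) (f : homc B E) (g : homc A B),
    fmap (compc f g) = compc (fmap g) (fmap f)
}.

Section ModuleCategories.
Variable S : nzRingType.

Let lidc (M : lmodType S) : {linear M -> M} := idfun.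
Let lcomp (M N P : lmodType S) (f : {linear N -> P}) (g : {linear M -> N}) :
  {linear M -> P} := f \o g.

Fact lcomp1c (M N : lmodType S) (f : {linear M -> N}) : lcomp (lidc N) f = f.
Proof. exact: linear_ext. Qed.
Fact lcompc1 (M N : lmodType S) (f : {linear M -> N}) : lcomp f (lidc M) = f.
Proof. exact: linear_ext. Qed.
Fact lcompA (M N P Q : lmodType S) (f : {linear P -> Q}) (g : {linear N -> P})
  (h : {linear M -> N}) : lcomp f (lcomp g h) = lcomp (lcomp f g) h.
Proof. exact: linear_ext. Qed.

Definition leftModCat : category :=
  @Category (lmodType S) (fun M N => {linear M -> N}) lidc lcomp
    lcomp1c lcompc1 lcompA.

End ModuleCategories.

Definition rightModCat (S : nzRingType) : category := leftModCat S^c.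

(* Main.v *)
Require Import Defs.
From HB Require Import structures.
From mathcomp Require Import all_boot all_order all_algebra.

Set Implicit Arguments.
Unset Strict Implicit.
Unset Printing Implicit Defensive.

Import GRing.Theory.
Local Open Scope ring_scope.

(** The map (h, m) |-> (r' |-> h (beta (m (x) r'))) is additive in both
    variables, and multiplication by a on h, resp. on m, becomes the left, resp.
    right, action of a on Hom_rR (R_f, I). As Psi^-1 is a bimodule map, a then
    acts on _fI through a^p when it multiplies h, which is the relation
    r a^p (x) h = r (x) a h, and through a when it multiplies m, which is
    R-linearity in m. For functoriality, an additive map is R[x, f]-linear as
    soon as it commutes with R and x, and psi^v commutes with x because psi
    commutes with each r' x. *)

Section BimodIsoInverse.
Variables (R : pzRingType) (U V : bimodType R) (Psi : bimodIso U V).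

(** [bimodIso] makes only the forward map a bimodule map; the inverse inherits each law by
    injectivity of [Psi]. *)
Lemma biso_invD : {morph biso_inv Psi : u v / u + v}.
Proof.
by move=> u v; apply: (can_inj (bisoK Psi)); rewrite raddfD /= !biso_invK.
Qed.

Lemma biso_invZ a v : biso_inv Psi (a *: v) = a *: biso_inv Psi v.
Proof. by apply: (can_inj (bisoK Psi)); rewrite linearZ_LR /= !biso_invK. Qed.

Lemma biso_inv_rscale v a :
  biso_inv Psi (rscale v a) = rscale (biso_inv Psi v) a.
Proof. by apply: (can_inj (bisoK Psi)); rewrite biso_rscale !biso_invK. Qed.

End BimodIsoInverse.

Section EvalHomTheory.
Variables (R : comNzRingType) (p : nat) (charRp : p \in [pchar R]).
Variables (I M : lmodType R).
Variable beta : rHom (tensor (central M) (Rf charRp)) (central M).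
Implicit Types (h : dual I M) (m n : M) (a : R).

Lemma evalHomDl h g m :
  evalHom beta (h + g) m = evalHom beta h m + evalHom beta g m.
Proof. exact: rHom_ext. Qed.

Lemma evalHomZl a h m : evalHom beta (a *: h) m = a *: evalHom beta h m.
Proof. exact: rHom_ext. Qed.

Lemma evalHomDr h m n :
  evalHom beta h (m + n) = evalHom beta h m + evalHom beta h n.
Proof.
apply: rHom_ext => r; rewrite /= -[LHS]/(h (beta _)).
by rewrite (tensDl (m : central M) n) rhomD raddfD.
Qed.

(** The tensor relation carries [a] from [m] into the argument in [Rf], and the right action on
    [rHom] is precomposition with that scaling. *)
Lemma evalHomZr h a m : evalHom beta h (a *: m) = rscale (evalHom beta h m) a.
Proof.
apply: rHom_ext => r.
by rewrite /= -[a *: m]/(rscale (m : central M) a) tensA.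
Qed.

End EvalHomTheory.

Section DualStructure.
Variables (R : comNzRingType) (p : nat) (charRp : p \in [pchar R]).
Variables (I M : lmodType R).
Variable Psi : bimodIso (fI charRp I) (rHom (Rf charRp) (central I)).
Variable beta : rHom (tensor (central M) (Rf charRp)) (central M).
Implicit Types (r : Rf charRp) (h : dual I M) (m : M).

(** The right action of [r] on [fI] is plain scaling in [I]. It is written so because linearity in
    [m] refers to [I], not to the Frobenius-twisted left action on [fI]. *)
Definition dual_act_fun r h m : I :=
  (r : R) *: (biso_inv Psi (evalHom beta h m) : I).

Fact dual_act_fun_linear r h : linear (dual_act_fun r h).
Proof.
move=> a m n; rewrite /dual_act_fun evalHomDr evalHomZr.
rewrite biso_invD biso_inv_rscale [LHS]scalerDr; congr (_ + _).
by rewrite [LHS](@scalerA R I) [RHS](@scalerA R I) mulrC.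
Qed.

HB.instance Definition _ r h :=
  GRing.isLinear.Build R M I *:%R (dual_act_fun r h) (dual_act_fun_linear r h).

Definition dual_act r (h : central (dual I M)) : dual I M :=
  (dual_act_fun r h : {linear M -> I}).

Fact dual_act_balanced : balanced dual_act.
Proof.
split=> [h r s|r h g|r a h]; apply: linear_ext => m.
- exact: (@scalerDl R I).
- rewrite /= /dual_act_fun [evalHom _ _ _](evalHomDl beta h g m) biso_invD.
  exact: (@scalerDr R I).
(* On the right, [a] acts on [fI] through a^p; on the left, [rscale r a] is a^p r. Both sides scale
   by the same element. *)
- rewrite /= /dual_act_fun [in RHS]evalHomZl biso_invZ [RHS](@scalerA R I).
  by rewrite mulrC.
Qed.

Fact tlift_dual_act_linear : linear (tlift dual_act).
Proof.
move=> a t s; rewrite tliftD; last exact: dual_act_balanced.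
congr (_ + _); move: t; have actD := tliftD dual_act_balanced.
(* Both sides are additive in the tensor, so pure tensors suffice. *)
apply: tens_ext => [x y|x y|r h].
- by rewrite scalerDr actD.
- by rewrite actD scalerDr.
rewrite scale_tens !tlift_tens; try exact: dual_act_balanced.
by apply: linear_ext => m; apply: esym; apply: (@scalerA R I).
Qed.

HB.instance Definition _ :=
  GRing.isLinear.Build R (tensor (Rf charRp) (central (dual I M))) (dual I M)
    *:%R (tlift dual_act) tlift_dual_act_linear.

Definition dual_alpha :
  {linear tensor (Rf charRp) (central (dual I M)) -> dual I M} :=
  tlift dual_act.

Lemma dual_alphaE r h m :
  dual_alpha (tens r (h : central (dual I M))) m
  = rscale (biso_inv Psi (evalHom beta h m)) r.
Proof.
by rewrite /dual_alpha /= tlift_tens //; apply: dual_act_balanced.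
Qed.

End DualStructure.

Section LeftModMorphism.
Variables (R : comNzRingType) (p : nat) (charRp : p \in [pchar R]).
Variables (H G : lmodType R).
Variable alpha : {linear tensor (Rf charRp) (central H) -> H}.
Variable gamma : {linear tensor (Rf charRp) (central G) -> G}.
Variable f : {linear H -> G}.

(** A skew polynomial acts by the sum of its coefficients times iterates of the action of x, so
    commuting with x passes to each iterate by induction. *)
Lemma leftMod_linear :
    (forall h : H, f (alpha (tens (1 : Rf charRp) (h : central H)))
       = gamma (tens (1 : Rf charRp) (f h : central G))) ->
  linear (f : leftMod alpha -> leftMod gamma).
Proof.
move=> fX P g h; rewrite [LHS](raddfD f); congr (_ + _).
rewrite [LHS]raddf_sum; apply: eq_bigr => i _ /=.
apply: etrans (linearZ_LR f _ _) _; apply: (congr1 (GRing.scale _)).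
by elim: (i : nat) => //= n IHn; rewrite fX IHn.
Qed.

End LeftModMorphism.

Section DualMorphism.
Variables (R : comNzRingType) (p : nat) (charRp : p \in [pchar R]).
Variables (I : lmodType R).
Variable Psi : bimodIso (fI charRp I) (rHom (Rf charRp) (central I)).
Variables (M N : lmodType (skewPoly charRp)^c) (psi : {linear M -> N}).

Definition res_fun (m : rightRes M) : rightRes N := psi m.

(** R acts on [rightRes] through the constants of R[x, f], with which [psi] commutes. *)
Fact res_fun_linear : linear res_fun.
Proof. by move=> a m n; rewrite /res_fun [LHS]linearP. Qed.

HB.instance Definition _ :=
  GRing.isLinear.Build R (rightRes M) (rightRes N) *:%R res_fun res_fun_linear.

Definition dual_fun (h : dual I (rightRes N)) : dual I (rightRes M) :=
  (h : {linear rightRes N -> I}) \o res_fun.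

Fact dual_fun_linear : linear dual_fun.
Proof. by move=> a g h; apply: linear_ext. Qed.

HB.instance Definition _ :=
  GRing.isLinear.Build R (dual I (rightRes N)) (dual I (rightRes M)) *:%R
    dual_fun dual_fun_linear.

Definition dual_leftMod_fun (h : leftMod (dual_alpha Psi (rightBeta N))) :
  leftMod (dual_alpha Psi (rightBeta M)) := dual_fun h.

(** The two sides send r to h (psi (m r x)) and h (psi (m) r x). *)
Lemma evalHom_dual_fun (h : dual I (rightRes N)) (m : rightRes M) :
  evalHom (rightBeta M) (dual_fun h) m
  = evalHom (rightBeta N) h (res_fun m).
Proof.
apply: rHom_ext => r; rewrite /= -[LHS]/(h (psi (rightBeta M _))).
rewrite -[RHS]/(h (rightBeta N _)) !rightBetaE.
by rewrite /ract linearZ_LR.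
Qed.

Fact dual_leftMod_linear : linear dual_leftMod_fun.
Proof.
(* Only commutation with x is left: the values at 1 (x) h agree, since [biso_inv Psi] is applied to
   equal homomorphisms. *)
apply: (leftMod_linear (f := dual_fun)) => h; apply: linear_ext => m.
rewrite [RHS]dual_alphaE evalHom_dual_fun.
exact: (dual_alphaE Psi (rightBeta N)).
Qed.

HB.instance Definition _ :=
  GRing.isLinear.Build (skewPoly charRp)
    (leftMod (dual_alpha Psi (rightBeta N)))
    (leftMod (dual_alpha Psi (rightBeta M))) *:%R
    dual_leftMod_fun dual_leftMod_linear.

Definition dual_leftMod :
  {linear leftMod (dual_alpha Psi (rightBeta N)) ->
          leftMod (dual_alpha Psi (rightBeta M))} := dual_leftMod_fun.

End DualMorphism.

Theorem proposition1p16 (R : comNzRingType) (p : nat)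
  (charRp : p \in [pchar R])
  (noethR : noetherian R) (finR : F_finite charRp)
  (I : lmodType R) (injI : injective_module I)
  (Psi : bimodIso (fI charRp I) (rHom (Rf charRp) (central I))) :
  exists D' : forall M : lmodType (skewPoly charRp)^c,
      {linear tensor (Rf charRp) (central (dual I (rightRes M)))
              -> dual I (rightRes M)},
    (forall (M : lmodType (skewPoly charRp)^c)
        (h : dual I (rightRes M)) (r : Rf charRp) (m : rightRes M),
      D' M (tens r (h : central (dual I (rightRes M)))) m
      = rscale (biso_inv Psi (evalHom (rightBeta M) h m)) r) /\
    exists F : contrafunctor (C := rightModCat (skewPoly charRp))
                 (D := leftModCat (skewPoly charRp)) (fun M => leftMod (D' M)),
      forall (M N : lmodType (skewPoly charRp)^c) (psi : {linear M -> N})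
        (h : dual I (rightRes N)) (m : rightRes M),
        (F M N psi h : dual I (rightRes M)) m = h (psi m).
Proof.
exists (fun M => dual_alpha Psi (rightBeta M)).
split=> [M h r m|]; first exact: dual_alphaE.
unshelve eexists.
  apply: (@Contrafunctor (rightModCat (skewPoly charRp))
    (leftModCat (skewPoly charRp)) _ (dual_leftMod Psi)) => [M|M N E f g].
  (* Precomposition respects identities and reverses composites; this is checked on each h, then on
     each element of the module. *)
  - by apply: linear_ext => h; apply: linear_ext.
  - by apply: linear_ext => h; apply: linear_ext.
by [].
Qed.
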